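(* Let $g:\mathcal{X}\to\mathcal{Z}$ be one-to-one and onto, let $\mathbf{f}$ be linearly equivariant with respect to $g$ with nonsingular matrix $\mathbf{Q}_g$, i.e. $\mathbf{f}(g(\mathbf{x}))=\mathbf{Q}_g\mathbf{f}(\mathbf{x})$ for all $\mathbf{x}\in\mathcal{X}$, and let $\tilde g(\boldsymbol\beta)=\mathbf{Q}_g^{-\mathsf T}\boldsymbol\beta$ for $\boldsymbol\beta\in\mathcal{B}$. Let $\boldsymbol\beta\in\mathcal{B}$. If $\xi^*$ is locally $D$-optimal on $\mathcal{X}$ at $\boldsymbol\beta$, then $(\xi^* )^g$ is locally $D$-optimal on $\mathcal{Z}$ at $\tilde{\boldsymbol\beta}=\tilde g(\boldsymbol\beta)$.
   Context: $\mathbf{f}$ is a vector of $p$ real regression functions defined on $\mathcal{X}$ and on $\mathcal{Z}$, with components linearly independent on $\mathcal{X}$; $\mathcal{B}\subseteq\mathbb{R}^p$ is the parameter region; $\lambda$ (the intensity function) is a positive real function defined on a set of reals containing all values $\mathbf{f}(\mathbf{x})^{\mathsf T}\boldsymbol\beta$, $\mathbf{x}\in\mathcal{X}$, $\boldsymbol\beta\in\mathcal{B}$. The same $\lambda$ is used on $\mathcal{Z}$ (with parameters in $\tilde g(\mathcal{B})$). A design $\xi$ on a region is given by finitely many distinct support points $\mathbf{x}_i$ of the region and weights $w_i>0$, $\sum_i w_i=1$. Its information matrix at $\boldsymbol\beta$ is $\mathbf{M}(\xi;\boldsymbol\beta)=\sum_i w_i\,\lambda(\mathbf{f}(\mathbf{x}_i)^{\mathsf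 T}\boldsymbol\beta)\,\mathbf{f}(\mathbf{x}_i)\mathbf{f}(\mathbf{x}_i)^{\mathsf T}$. The image $\xi^g$ is the design on $\mathcal{Z}$ with support points $g(\mathbf{x}_i)$ and weights $w_i$. A design $\xi^*$ is locally $D$-optimal at $\boldsymbol\beta$ on a region if it minimizes, over all designs on that region, $\det(\mathbf{M}(\xi;\boldsymbol\beta)^{-1})$, which is set to $\infty$ when $\mathbf{M}(\xi;\boldsymbol\beta)$ is singular. $\mathbf{Q}^{-\mathsf T}$ denotes the inverse of the transpose of $\mathbf{Q}$. *)

(* Defs.v *)
From mathcomp Require Import all_boot all_order all_algebra.
From mathcomp Require Import classical_sets functions reals constructive_ereal.

Set Implicit Arguments.
Unset Strict Implicit.
Unset Printing Implicit Defensive.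

Import Order.TTheory GRing.Theory Num.Theory.
Local Open Scope classical_set_scope.
Local Open Scope ring_scope.

(* The ambient type T only serves to host both regions X and Z, so that a
   single regression vector f makes sense on each of them; T carries no
   structure, and f, g and lambda are total functions whose values outside
   the relevant sets never matter. *)

Definition lin_indep_on (R : realType) (T : Type) (p : nat)
    (X : set T) (f : T -> 'cV[R]_p) : Prop :=
  forall c : 'I_p -> R,
    (forall x, X x -> \sum_(j < p) c j * f x j 0 = 0) -> forall j, c j = 0.

Definition linpred (R : realType) (T : Type) (p : nat)
    (f : T -> 'cV[R]_p) (b : 'cV[R]_p) (x : T) : R :=
  ((f x)^T *m b) 0 0.

Record design (R : realType) (T : Type) (X : set T) : Type := Design {
  dsize : nat;
  dpoint : 'I_dsize -> T;
  dweight : 'I_dsize -> R;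
  dpoint_inj : injective dpoint;
  dpoint_in : forall i, X (dpoint i);
  dweight_gt0 : forall i, 0 < dweight i;
  dweight_sum : \sum_(i < dsize) dweight i = 1 }.

Arguments design R {T} X.
Arguments dpoint {R T X} d i.
Arguments dweight {R T X} d i.
Arguments dpoint_inj {R T X} d.
Arguments dpoint_in {R T X} d i.
Arguments dweight_gt0 {R T X} d i.

Definition info_mx (R : realType) (T : Type) (p : nat) (f : T -> 'cV[R]_p)
    (lambda : R -> R) (X : set T) (xi : design R X) (b : 'cV[R]_p) : 'M[R]_p :=
  \sum_(i < dsize xi)
    (dweight xi i * lambda (linpred f b (dpoint xi i))) *:
      (f (dpoint xi i) *m (f (dpoint xi i))^T).

Definition D_criterion (R : realType) (T : Type) (p : nat) (f : T -> 'cV[R]_p)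
    (lambda : R -> R) (X : set T) (xi : design R X) (b : 'cV[R]_p) : \bar R :=
  if info_mx f lambda xi b \in unitmx
  then (\det (invmx (info_mx f lambda xi b)))%:E
  else +oo%E.

Definition locally_D_optimal (R : realType) (T : Type) (p : nat)
    (f : T -> 'cV[R]_p) (lambda : R -> R) (X : set T) (b : 'cV[R]_p)
    (xi : design R X) : Prop :=
  forall eta : design R X,
    (D_criterion f lambda xi b <= D_criterion f lambda eta b)%E.

Lemma image_point_inj (R : realType) (T : Type) (X Z : set T) (g : T -> T)
    (g_bij : set_bij X Z g) (xi : design R X) :
  injective (fun i => g (dpoint xi i)).
Proof.
case: g_bij => _ g_inj _ i j gij.
by apply: (dpoint_inj xi); apply: g_inj gij; rewrite inE; apply: dpoint_in.
Qed.

Arguments image_point_inj {R T X Z g} g_bij xi.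

Lemma image_point_in (R : realType) (T : Type) (X Z : set T) (g : T -> T)
    (g_bij : set_bij X Z g) (xi : design R X) i :
  Z (g (dpoint xi i)).
Proof. by case: g_bij => g_fun _ _; apply: g_fun; apply: dpoint_in. Qed.

Arguments image_point_in {R T X Z g} g_bij xi i.

Definition image_design (R : realType) (T : Type) (X Z : set T) (g : T -> T)
    (g_bij : set_bij X Z g) (xi : design R X) : design R Z :=
  Design (image_point_inj g_bij xi) (image_point_in g_bij xi)
    (dweight_gt0 xi) (dweight_sum xi).

Definition linearly_equivariant (R : realType) (T : Type) (p : nat)
    (X : set T) (f : T -> 'cV[R]_p) (g : T -> T) (Q : 'M[R]_p) : Prop :=
  forall x, X x -> f (g x) = Q *m f x.

Definition param_transform (R : realType) (p : nat) (Q : 'M[R]_p)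
    (b : 'cV[R]_p) : 'cV[R]_p :=
  invmx Q^T *m b.

(* Main.v *)
(* Equivariance leaves the linear predictor unchanged and turns the information
   matrix [M] into [Q M Q^T], so the criterion is multiplied by the positive
   constant [(det Q)^-2], which depends neither on the design nor on the
   parameter. As every design on [Z] is the image of one on [X], minimizers
   are carried to minimizers. *)
Require Import Defs.
From mathcomp Require Import all_boot all_order all_algebra.
From mathcomp Require Import classical_sets functions reals constructive_ereal.
From mathcomp Require Import boolp.

Set Implicit Arguments.
Unset Strict Implicit.
Unset Printing Implicit Defensive.

Import Order.TTheory GRing.Theory Num.Theory.
Local Open Scope classical_set_scope.
Local Open Scope ring_scope.

(** Pulling each support point of [eta] back along [g] and keeping the weights gives the required
    design on [X]. *)
Lemma image_design_surj (R : realType) (T : Type) (X Z : set T) (g : T -> T)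
    (g_bij : set_bij X Z g) (eta : design R Z) :
  exists xi : design R X, image_design g_bij xi = eta.
Proof.
case: eta => n z w z_inj z_in w_gt0 w_sum.
have [_ _ g_surj] := g_bij.
(* The relation to [z] is an equality of functions rather than a pointwise one, so that [z] can
   later be eliminated by it. *)
have [x x_in gx] : exists2 x : 'I_n -> T,
    forall i, X (x i) & (fun i => g (x i)) = z.
  have /choice[x xP] : forall i, exists t, X t /\ g t = z i.
    by move=> i; have [t Xt gt] := g_surj _ (z_in i); exists t.
  by exists x => [i|]; [case: (xP i)|apply/funext => i; case: (xP i)].
have x_inj : injective x.
  by move=> i j xij; apply: z_inj; rewrite -gx /= xij.
(* Once [z] is replaced by the composite of [g] and [x], the two designs differ only in their proof
   fields. *)
exists (Design x_inj x_in w_gt0 w_sum); case: _ / gx z_inj z_in => z_inj z_in.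
by congr Design; apply: Prop_irrelevance.
Qed.

(** The factor [Q^T] from the transposed regression vector cancels the [invmx Q^T] of the
    transformed parameter. *)
Lemma linpred_equivariant (R : realType) (T : Type) (p : nat) (X : set T)
    (f : T -> 'cV[R]_p) (g : T -> T) (Q : 'M[R]_p) (b : 'cV[R]_p) (x : T) :
  Q \in unitmx -> linearly_equivariant X f g Q -> X x ->
  linpred f (param_transform Q b) (g x) = linpred f b x.
Proof.
move=> Q_unit fg Xx; rewrite /linpred /param_transform fg// trmx_mul.
by rewrite -mulmxA mulKVmx// unitmx_tr.
Qed.

(** Termwise: the intensities agree, and each rank-one matrix is conjugated by [Q]. *)
Lemma info_mx_image (R : realType) (T : Type) (p : nat) (X Z : set T)
    (f : T -> 'cV[R]_p) (lambda : R -> R) (g : T -> T)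
    (g_bij : set_bij X Z g) (Q : 'M[R]_p) (b : 'cV[R]_p) (xi : design R X) :
  Q \in unitmx -> linearly_equivariant X f g Q ->
  info_mx f lambda (image_design g_bij xi) (param_transform Q b) =
  Q *m info_mx f lambda xi b *m Q^T.
Proof.
move=> Q_unit fg; rewrite /info_mx mulmx_sumr mulmx_suml.
apply: eq_bigr => i _ /=; have Xi := dpoint_in xi i.
rewrite (linpred_equivariant b Q_unit fg Xi) fg// trmx_mul.
by rewrite -scalemxAr -scalemxAl !mulmxA.
Qed.

Lemma D_criterion_image (R : realType) (T : Type) (p : nat) (X Z : set T)
    (f : T -> 'cV[R]_p) (lambda : R -> R) (g : T -> T)
    (g_bij : set_bij X Z g) (Q : 'M[R]_p) (b : 'cV[R]_p) (xi : design R X) :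
  Q \in unitmx -> linearly_equivariant X f g Q ->
  D_criterion f lambda (image_design g_bij xi) (param_transform Q b) =
  ((\det Q ^- 2)%:E * D_criterion f lambda xi b)%E.
Proof.
move=> Q_unit fg; rewrite /D_criterion info_mx_image//.
have detQ : \det Q != 0 by rewrite -unitfE -unitmxE.
(* As [Q] is invertible, both information matrices are singular or neither is. *)
rewrite !unitmx_mul unitmx_tr Q_unit andbT /=; case: ifP => _.
  by rewrite -EFinM !det_inv !det_mulmx det_tr mulrAC -expr2 invfM.
(* In the singular case strict positivity of the factor matters, since [0 * +oo] is [0]. *)
by rewrite gt0_muley// lte_fin invr_gt0 exprn_even_gt0.
Qed.

Theorem corollary1 (R : realType) (T : Type) (p : nat) (X Z : set T)
    (f : T -> 'cV[R]_p) (B : set 'cV[R]_p) (D : set R) (lambda : R -> R)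
    (f_indep : lin_indep_on X f)
    (lambda_dom : forall x b, X x -> B b -> D (linpred f b x))
    (lambda_gt0 : forall u, D u -> 0 < lambda u)
    (g : T -> T) (g_bij : set_bij X Z g)
    (Q : 'M[R]_p) (Q_unit : Q \in unitmx)
    (fg : linearly_equivariant X f g Q)
    (b : 'cV[R]_p) (Bb : B b) (xi : design R X)
    (xi_opt : locally_D_optimal f lambda b xi) :
  locally_D_optimal f lambda (param_transform Q b) (image_design g_bij xi).
Proof.
move=> eta; have [xi' <-] := image_design_surj g_bij eta.
rewrite !D_criterion_image//; apply: lee_wpmul2l; last exact: xi_opt.
by rewrite lee_fin invr_ge0 sqr_ge0.
Qed.
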